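(* Let $n\ge 1$ and let $f_{2,n}, f_{3,n} : [1]\times[2]\times\cdots\times[n]\to S_n$ be the bijections defined in the context. The number of fixed points of the map $f_{2,n}\circ f_{3,n}^{-1}: S_n\to S_n$ is $2^{n-1}$. Namely, the fixed points are exactly the permutations of the form $f_{2,n}(w)=f_{3,n}(w)$, where $w\in[1]\times[2]\times\cdots\times[n]$ is a word all of whose letters belong to $\{1,2\}$.
   Context: Notation: $[m]=\{1,2,\dots,m\}$, and $S_n$ is the set of permutations of $[n]$. A permutation $\sigma$ is identified with its one-line notation, and $\sigma[i]$ is its $i$-th entry from the left, i.e. $\sigma[i]$ is the image of $i$ under $\sigma$. In cycle notation, $(a_1a_2\cdots a_k)$ denotes the cycle $a_1\mapsto a_2\mapsto\cdots\mapsto a_k\mapsto a_1$. A word is an element $w\in[1]\times[2]\times\cdots\times[n]$; $w[i]$ is its $i$-th letter from the left, so $1\le w[i]\le i$ (in particular $w[1]=1$). Definition of $f_{2,n}$: read $w$ backwards, for $i=n,n-1,\dots,1$, starting from the empty one-line word. At step $i$, append at the right end the $w[i]$-th smallest element of $[n]$ that has not yet been placed. The resulting one-line word is $f_{2,n}(w)$. (Examples for $n=3$: $112\mapsto 213$, $113\mapsto 312$, $121\mapsto 132$.) Definition of $f_{3,n}$: $f_{3,n}(w)$ is built in cycle notation. Start with an open cycle ''$(1$'', so $1$ is used. Read $w$ backwards, for $i=n,n-1,\dots,1$. At step $i$: if $w[i]>1$, append on the right, in the currently open cycle, the $(w[i]-1)$-th smallest element of $[n]$ not yet used; if $w[i]=1$,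 close the current cycle and, if unused elements remain, open a new cycle whose first element is the smallest unused element. (At the last step $i=1$, $w[1]=1$ and all elements have been used, so the final cycle is just closed.) The result is the cycle notation of the permutation $f_{3,n}(w)$. (Examples for $n=3$: $111\mapsto(1)(2)(3)$, $112\mapsto(12)(3)$, $113\mapsto(13)(2)$, $121\mapsto(1)(23)$, $122\mapsto(123)$, $123\mapsto(132)$.) Both maps are bijections. *)

(* Defs.v *)
From mathcomp Require Import all_boot all_fingroup.

Set Implicit Arguments.
Unset Strict Implicit.
Unset Printing Implicit Defensive.

(* The set [m] = {1, ..., m} is 'I_m, the ordinal k standing for k + 1; S_n is
   'S_n.  Letters of words are nevertheless counted from 1, through [letter]. *)

Definition word (n : nat) := {dffun forall i : 'I_n, 'I_i.+1}.

Definition letter (n : nat) (w : word n) (i : 'I_n) : nat := (w i : nat).+1.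

Definition backward (n : nat) (w : word n) : seq nat :=
  [seq letter w i | i <- rev (enum 'I_n)].

Section Algorithms.
Variable T : eqType.

(* [ls] lists the letters still to be read, and [unused] the unused elements in
   increasing order: for a >= 1 the a-th smallest one has index a - 1.  The
   default of [nth] is never reached with the letters of a word. *)
Fixpoint one_line (ls : seq nat) (unused : seq T) : seq T :=
  match ls, unused with
  | a :: ls', x0 :: _ =>
      let x := nth x0 unused a.-1 in x :: one_line ls' (rem x unused)
  | _, _ => [::]
  end.

(* [cur] is the open cycle.  The last branch (letter > 1 but no unused element)
   never occurs with the letters of a word. *)
Fixpoint cycles (ls : seq nat) (cur unused : seq T) : seq (seq T) :=
  match ls with
  | [::] => [::]
  | a :: ls' =>
      match a == 1, unused with
      | true, x :: unused' => cur :: cycles ls' [:: x] unused'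
      | true, [::] => [:: cur]
      | false, x0 :: _ =>
          let x := nth x0 unused (a.-1).-1 in
          cycles ls' (rcons cur x) (rem x unused)
      | false, [::] => [:: cur]
      end
  end.

Lemma nth_head_mem (x0 : T) u k : nth x0 (x0 :: u) k \in x0 :: u.
Proof.
case: (ltnP k (size (x0 :: u))) => [|h]; first exact: mem_nth.
by rewrite nth_default // mem_head.
Qed.

Lemma one_line_cons a ls x0 u (x := nth x0 (x0 :: u) a.-1) :
  one_line (a :: ls) (x0 :: u) = x :: one_line ls (rem x (x0 :: u)).
Proof. by []. Qed.

Lemma cycles_close ls cur x u :
  cycles (1 :: ls) cur (x :: u) = cur :: cycles ls [:: x] u.
Proof. by []. Qed.

Lemma cycles_extend a ls cur x0 u (x := nth x0 (x0 :: u) (a.-1).-1) :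
  a != 1 ->
  cycles (a :: ls) cur (x0 :: u) = cycles ls (rcons cur x) (rem x (x0 :: u)).
Proof. by rewrite /= => /negPf ->. Qed.

Lemma perm_one_line ls unused :
  size ls = size unused -> perm_eq (one_line ls unused) unused.
Proof.
elim: ls unused => [|a ls IH] [|x0 u] // [sz].
have xu := nth_head_mem x0 u a.-1.
rewrite one_line_cons; set x := nth _ _ _ in xu *.
rewrite perm_sym (permPl (perm_to_rem xu)) perm_cons perm_sym.
by apply: IH; rewrite size_rem.
Qed.

Lemma perm_flatten_cycles ls cur unused :
  size ls = (size unused).+1 ->
  perm_eq (flatten (cycles ls cur unused)) (cur ++ unused).
Proof.
elim: ls cur unused => [|a ls IH] cur [|x0 u] // [sz].
  by rewrite [cycles _ _ _]/=; case: (a == 1); rewrite /= cats0.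
have [->|a1] := eqVneq a 1.
  by rewrite cycles_close /= perm_cat2l; apply: (IH [:: x0]).
have xu := nth_head_mem x0 u (a.-1).-1.
rewrite cycles_extend //; set x := nth _ _ _ in xu *.
apply: perm_trans (IH _ _ _) _; first by rewrite size_rem.
by rewrite cat_rcons perm_cat2l perm_sym perm_to_rem.
Qed.

End Algorithms.

Example one_line_112 : one_line [:: 2; 1; 1] [:: 1; 2; 3] = [:: 2; 1; 3].
Proof. by []. Qed.
Example one_line_113 : one_line [:: 3; 1; 1] [:: 1; 2; 3] = [:: 3; 1; 2].
Proof. by []. Qed.
Example one_line_121 : one_line [:: 1; 2; 1] [:: 1; 2; 3] = [:: 1; 3; 2].
Proof. by []. Qed.
Example cycles_111 :
  cycles [:: 1; 1; 1] [:: 1] [:: 2; 3] = [:: [:: 1]; [:: 2]; [:: 3]].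
Proof. by []. Qed.
Example cycles_112 :
  cycles [:: 2; 1; 1] [:: 1] [:: 2; 3] = [:: [:: 1; 2]; [:: 3]].
Proof. by []. Qed.
Example cycles_113 :
  cycles [:: 3; 1; 1] [:: 1] [:: 2; 3] = [:: [:: 1; 3]; [:: 2]].
Proof. by []. Qed.
Example cycles_121 :
  cycles [:: 1; 2; 1] [:: 1] [:: 2; 3] = [:: [:: 1]; [:: 2; 3]].
Proof. by []. Qed.
Example cycles_122 : cycles [:: 2; 2; 1] [:: 1] [:: 2; 3] = [:: [:: 1; 2; 3]].
Proof. by []. Qed.
Example cycles_123 : cycles [:: 3; 2; 1] [:: 1] [:: 2; 3] = [:: [:: 1; 3; 2]].
Proof. by []. Qed.

Section Maps.
Variable n : nat.
Implicit Type w : word n.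

Definition f2_word w : seq 'I_n := one_line (backward w) (enum 'I_n).

Lemma size_backward w : size (backward w) = n.
Proof. by rewrite size_map size_rev size_enum_ord. Qed.

Lemma f2_word_perm w : perm_eq (f2_word w) (enum 'I_n).
Proof. by apply: perm_one_line; rewrite size_backward size_enum_ord. Qed.

Lemma f2_word_inj w : injective (fun i : 'I_n => nth i (f2_word w) i).
Proof.
have pw := f2_word_perm w => i j.
have szw : size (f2_word w) = n by rewrite (perm_size pw) size_enum_ord.
rewrite (set_nth_default i j) ?szw // => /eqP.
rewrite nth_uniq ?szw // => [/eqP/val_inj //|].
by rewrite (perm_uniq pw) enum_uniq.
Qed.

Definition f2 w : 'S_n := perm (@f2_word_inj w).

Definition f3_cycles w : seq (seq 'I_n) :=
  if enum 'I_n is x :: unused then cycles (backward w) [:: x] unused else [::].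

Lemma perm_flatten_f3_cycles w : perm_eq (flatten (f3_cycles w)) (enum 'I_n).
Proof.
rewrite /f3_cycles; case E: (enum 'I_n) => [//|x u].
by apply: perm_flatten_cycles; rewrite size_backward -[n in LHS]size_enum_ord E.
Qed.

End Maps.

(* The cycle (a_1 ... a_k), with a_1, ..., a_k distinct; [undup] only serves to
   make the definition total. *)
Definition cycle_perm (T : finType) (c : seq T) : {perm T} :=
  perm (can_inj (prev_next (undup_uniq c))).

(* By [perm_flatten_f3_cycles] the factors are disjoint cycles covering [n], so
   their order is irrelevant. *)
Definition f3 (n : nat) (w : word n) : 'S_n :=
  (\prod_(c <- f3_cycles w) cycle_perm c)%g.

Lemma cycle_permE (T : finType) (c : seq T) x :
  uniq c -> cycle_perm c x = next c x.
Proof. by move=> Uc; rewrite permE undup_id. Qed.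

Lemma cycle_perm_out (T : finType) (c : seq T) x :
  x \notin c -> cycle_perm c x = x.
Proof. by move=> xc; rewrite permE next_nth mem_undup (negPf xc). Qed.

Lemma prod_cycle_perm (T : finType) (cs : seq (seq T)) c x :
  uniq (flatten cs) -> c \in cs -> x \in c ->
  (\prod_(d <- cs) cycle_perm d)%g x = next c x.
Proof.
have out (ds : seq (seq T)) y : y \notin flatten ds ->
    (\prod_(d <- ds) cycle_perm d)%g y = y.
  elim: ds => [|d ds IH] /=; first by rewrite big_nil perm1.
  rewrite mem_cat negb_or => /andP[yd yds].
  by rewrite big_cons permM cycle_perm_out // IH.
elim: cs => // d cs IH; rewrite /= cat_uniq => /and3P[Ud /hasPn dis Ucs].
rewrite big_cons permM inE => /predU1P[-> xd | ccs xc].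
  rewrite cycle_permE // out //.
  by apply/negP=> /dis /=; rewrite mem_next xd.
rewrite cycle_perm_out; first exact: IH.
by apply: (dis x); apply/flattenP; exists c.
Qed.

Lemma f3E n (w : word n) c x :
  c \in f3_cycles w -> x \in c -> f3 w x = next c x.
Proof.
apply: prod_cycle_perm.
by rewrite (perm_uniq (perm_flatten_f3_cycles w)) enum_uniq.
Qed.

Section CyclesInjective.
Variable T : eqType.
Implicit Types (cur unused : seq T).

Fixpoint valid_letters (ls : seq nat) : bool :=
  if ls is a :: ls' then (0 < a <= size ls) && valid_letters ls' else true.

Lemma cycles_prefix ls cur unused : size ls = (size unused).+1 ->
  exists d rest, cycles ls cur unused = (cur ++ d) :: rest.
Proof.
elim: ls cur unused => [//|a ls IH] cur [|x0 u] [sz].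
  by exists [::], [::]; rewrite /= cats0; case: (a == 1).
have [->|a1] := eqVneq a 1.
  by rewrite cycles_close; exists [::], (cycles ls [:: x0] u); rewrite cats0.
have xu := nth_head_mem x0 u (a.-1).-1.
rewrite cycles_extend //; set x := nth _ _ _ in xu *.
have [|d [rest ->]] := IH (rcons cur x) (rem x (x0 :: u)).
  by rewrite size_rem.
by exists (x :: d), rest; rewrite cat_rcons.
Qed.

Lemma next_cat_cons p (z x : T) q :
  uniq (p ++ [:: z, x & q]) -> next (p ++ [:: z, x & q]) z = x.
Proof.
move=> U; have := next_rot (size p) U z.
by rewrite rot_size_cat /= eqxx.
Qed.

Lemma next_rcons_last (p : seq T) z :
  uniq (rcons p z) -> next (rcons p z) z = head z (rcons p z).
Proof.
case: p => [|h p] U; first by rewrite /= eqxx.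
have := next_rot (size (h :: p)) U z.
by rewrite -cats1 rot_size_cat => <-; rewrite /= eqxx.
Qed.

Lemma cycles_first (s : T -> T) a ls p z unused :
  size ls = size unused -> 0 < a <= (size ls).+1 ->
  uniq (rcons p z ++ unused) ->
  {in cycles (a :: ls) (rcons p z) unused, forall c, {in c, s =1 next c}} ->
  s z = if a == 1 then head z (rcons p z) else nth z unused (a.-1).-1.
Proof.
case: unused => [|x0 u] sz a_ok U s_next.
  move: a_ok; rewrite sz; case: a s_next => [|[|a]] //= s_next _.
  rewrite cats0 in U.
  by rewrite (s_next (rcons p z)) ?mem_head ?mem_rcons ?mem_head
             ?next_rcons_last.
have [a1|a1] := eqVneq a 1.
  rewrite a1 cycles_close in s_next.
  rewrite (s_next (rcons p z)) ?mem_head ?mem_rcons ?mem_head //.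
  by rewrite next_rcons_last //; move: U; rewrite cat_uniq => /andP[].
have lt_a : (a.-1).-1 < size (x0 :: u).
  by rewrite -sz; case: a a1 a_ok {s_next} => [|[|a]].
have Ufl : uniq (flatten (cycles (a :: ls) (rcons p z) (x0 :: u))).
  by rewrite (perm_uniq (perm_flatten_cycles _ _)) //= sz.
rewrite cycles_extend // (set_nth_default z) // in s_next Ufl.
set x := nth z _ _ in s_next Ufl *.
have xu : x \in x0 :: u by apply: mem_nth.
have [|d [rest E]] := @cycles_prefix ls (rcons (rcons p z) x) (rem x (x0 :: u)).
  by rewrite size_rem.
move: s_next Ufl; rewrite E /= cat_uniq => s_next /andP[Uc _].
have Ec : rcons (rcons p z) x ++ d = p ++ [:: z, x & d] by rewrite !cat_rcons.
rewrite Ec in s_next Uc.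
rewrite (s_next (p ++ [:: z, x & d])) ?mem_head ?next_cat_cons //.
by rewrite mem_cat mem_head orbT.
Qed.

Lemma cycles_inj (s : T -> T) ls1 ls2 cur unused :
  cur != [::] -> uniq (cur ++ unused) ->
  size ls1 = (size unused).+1 -> size ls2 = (size unused).+1 ->
  valid_letters ls1 -> valid_letters ls2 ->
  {in cycles ls1 cur unused, forall c, {in c, s =1 next c}} ->
  {in cycles ls2 cur unused, forall c, {in c, s =1 next c}} ->
  ls1 = ls2.
Proof.
elim: ls1 ls2 cur unused => [//|a ls1 IH] [//|b ls2] cur unused.
case/lastP: cur => // p z _ U [sz1] [sz2] /andP[a_ok v1] /andP[b_ok v2] n1 n2.
have sa := cycles_first sz1 a_ok U n1; have sb := cycles_first sz2 b_ok U n2.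
have hd : head z (rcons p z) \notin unused.
  move: U; rewrite cat_uniq => /and3P[_ /hasPn dis _].
  by apply/negP=> /dis /negP; apply; case: (p) => [|h q]; rewrite /= mem_head.
have Uu : uniq unused by move: U; rewrite cat_uniq => /and3P[].
have lt (k : nat) (ls : seq nat) : k != 1 -> 0 < k <= (size ls).+1 ->
    size ls = size unused -> (k.-1).-1 < size unused.
  by case: k => [|[|k]] // _ /andP[_ ?] <-.
have eq_ab : a = b.
  move: sa sb; case: eqVneq => [->|a1]; case: eqVneq => [->//|b1] -> E.
  - by case/negP: hd; rewrite E mem_nth // (lt _ ls2).
  - by case/negP: hd; rewrite -E mem_nth // (lt _ ls1).
  move/eqP: E; rewrite nth_uniq ?(lt a ls1) ?(lt b ls2) //.
  by case: a b a1 b1 a_ok b_ok {n1 n2} => [|[|a]] [|[|b]] //= _ _ _ _ /eqP ->.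
subst b; congr (_ :: _).
case: unused U sz1 sz2 n1 n2 {hd Uu lt sa sb} => [|x0 u] U sz1 sz2 n1 n2.
  by case: ls1 ls2 sz1 sz2 {IH v1 v2 n1 n2 a_ok b_ok} => [|? ?] [|? ?].
have [a1|a1] := eqVneq a 1.
  rewrite a1 !cycles_close in n1 n2.
  apply: (IH ls2 [:: x0] u) => //.
  - by move: U; rewrite cat_uniq => /and3P[].
  - by move=> c ci; apply: n1; rewrite inE ci orbT.
  - by move=> c ci; apply: n2; rewrite inE ci orbT.
have xu := nth_head_mem x0 u (a.-1).-1.
rewrite !cycles_extend // in n1 n2; set x := nth _ _ _ in xu n1 n2.
apply: (IH ls2 (rcons (rcons p z) x) (rem x (x0 :: u))) => //.
- by case: (rcons p z).
- rewrite cat_rcons; move: U.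
  rewrite (@perm_uniq _ _ (rcons p z ++ x :: rem x (x0 :: u))) //.
  by rewrite perm_cat2l perm_to_rem.
- by rewrite size_rem.
- by rewrite size_rem.
Qed.

End CyclesInjective.

Section Inverse.
Variable n : nat.
Implicit Type w : word n.

Lemma nth_backward w (i : 'I_n) : nth 0 (backward w) (rev_ord i) = letter w i.
Proof.
rewrite (nth_map i) ?size_rev ?size_enum_ord // nth_rev size_enum_ord //.
have e : n - (rev_ord i).+1 = i by rewrite /= -subSn // subSS subKn // ltnW.
by congr letter; apply: ord_inj; rewrite nth_enum_ord e.
Qed.

Lemma backward_inj : injective (@backward n).
Proof.
move=> w1 w2 E; apply/ffunP => i; apply: val_inj; apply: succn_inj.
by have := nth_backward w1 i; rewrite E nth_backward.
Qed.

Lemma valid_lettersP ls :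
  (forall k, k < size ls -> 0 < nth 0 ls k <= size ls - k) -> valid_letters ls.
Proof.
elim: ls => [//|a ls IH] H; rewrite [valid_letters _]/=.
by rewrite (H 0) //=; apply: IH => k; apply: (H k.+1).
Qed.

Lemma valid_backward w : valid_letters (backward w).
Proof.
apply: valid_lettersP => k; rewrite size_backward => lt_kn.
have := nth_backward w (rev_ord (Ordinal lt_kn)); rewrite rev_ordK /= => ->.
have <- : (rev_ord (Ordinal lt_kn)).+1 = n - k by rewrite /= -subSn // subSS.
exact: ltn_ord.
Qed.

Lemma f3_inj : injective (@f3 n).
Proof.
move=> w1 w2 E; apply: backward_inj.
have n1 : {in f3_cycles w1, forall c, {in c, f3 w1 =1 next c}}.
  by move=> c cw x; apply: f3E.
have n2 : {in f3_cycles w2, forall c, {in c, f3 w1 =1 next c}}.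
  by move=> c cw x; rewrite E; apply: f3E.
have := enum_uniq 'I_n; have := size_enum_ord n.
move: n1 n2; rewrite /f3_cycles; case: (enum 'I_n) => [|x u] n1 n2 sz U.
  by rewrite (size0nil (etrans (size_backward w1) (esym sz)))
             (size0nil (etrans (size_backward w2) (esym sz))).
by apply: (cycles_inj (s := f3 w1) (cur := [:: x]) (unused := u));
  rewrite ?size_backward ?valid_backward.
Qed.

Lemma card_word : #|{: word n}| = n`!.
Proof.
rewrite card_dep_ffun fact_prod foldrE big_map big_enum /=.
rewrite big_add1 big_mkord; apply: eq_bigr => i _; exact: card_ord.
Qed.

Lemma f3_onto (s : 'S_n) : s \in codom (@f3 n).
Proof. by apply: (inj_card_onto f3_inj); rewrite card_word card_Sn. Qed.

Definition f3_inv (s : 'S_n) : word n := iinv (f3_onto s).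

Lemma f3K : cancel (@f3 n) f3_inv.
Proof. by move=> w; apply: (iinv_f f3_inj). Qed.

Lemma f3_invK : cancel f3_inv (@f3 n).
Proof. by move=> s; apply: f_iinv. Qed.

Lemma f3_bij : bijective (@f3 n).
Proof. exact: (Bijective f3K f3_invK). Qed.

End Inverse.

(* Main.v *)
Require Import Defs.
From mathcomp Require Import all_boot all_fingroup.

(** Write the cycles of [f3 w] one after the other, in the order in which the
    algorithm produces them, each starting from its first element.  The two
    algorithms always choose from the same list: the values that [f2] has not
    placed are, in order, the first element of the open cycle followed by the
    unused elements of [f3].  Indeed the letter 1 makes [f2] place the first
    element of the open cycle, and it makes [f3] close that cycle, that is, send
    the last written element z to that same first element; a letter a > 1
    makes [f2] place the (a-1)-th unused element, and makes [f3] send z to it.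
    So the image under [f3 w] of the k-th element written is the k-th entry of
    the one-line word of [f2 w] ([map_flatten_cycles]).

    As [f3 w] is injective, [f2 w = f3 w] therefore holds exactly when erasing
    the parentheses of the cycle notation leaves 1, 2, ..., n
    ([f2_eq_f3_flatten]).  The letters 1 and 2 write the smallest unused element
    next, whereas a larger letter skips it; hence this happens exactly when all
    letters are at most 2 ([flatten_cycles_in_order]).  There are 2^(n-1) such
    words, since the first letter is always 1 and each other one is free, and
    [f3] carries them injectively onto the fixed points. *)

Set Implicit Arguments.
Unset Strict Implicit.
Unset Printing Implicit Defensive.

Section Algorithms.
Variable T : eqType.
Implicit Types (p t unused : seq T) (z : T).

(** Since a partially built cycle [rcons p z] may be open, only the part [t] of
    the cycle notation from its last element [z] on corresponds to the letters
    that remain to be read. *)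
Lemma map_flatten_cycles (s : T -> T) ls p z unused :
  size ls = (size unused).+1 -> valid_letters ls ->
  uniq (rcons p z ++ unused) ->
  {in cycles ls (rcons p z) unused, forall c, {in c, s =1 next c}} ->
  exists2 t, flatten (cycles ls (rcons p z) unused) = p ++ t
           & map s t = one_line ls (head z (rcons p z) :: unused).
Proof.
elim: ls p z unused => [//|a ls IH] p z unused [sz] /andP[].
rewrite [size _]/= => a_ok v U s_next.
have sz_z := cycles_first sz a_ok U s_next.
(* Both algorithms choose the same element; the shift by one in the index of
   [f3] is due to [m], the first element of the open cycle. *)
rewrite one_line_cons; set m := head z _ in sz_z *.
have def_sz : nth m (m :: unused) a.-1 = s z.
  rewrite sz_z; case: a a_ok {s_next sz_z} => [|[|a]] //= a_lt.
  by apply: set_nth_default; rewrite -sz.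
rewrite def_sz.
case: unused sz U s_next sz_z def_sz => [|x0 u] sz U s_next sz_z def_sz.
  have {}a_ok: a = 1 by move: a_ok; rewrite sz; case: (a) => [|[]].
  exists [:: z]; first by rewrite a_ok /= cats0 cats1.
  by rewrite (size0nil sz).
have [a1|a1] := eqVneq a 1.
  rewrite a1 cycles_close in s_next *; rewrite a1 eqxx in sz_z.
  have [|c ci|t Et Es] := IH [::] x0 u sz v.
  - by move: U; rewrite cat_uniq => /and3P[].
  - by apply: s_next; rewrite inE ci orbT.
  exists (z :: t); first by rewrite /= Et cat_rcons.
  by rewrite /= Es sz_z eqxx.
rewrite (negPf a1) in sz_z.
have lt_a : (a.-1).-1 < size (x0 :: u).
  by rewrite -sz; case: a a1 a_ok {s_next sz_z def_sz} => [|[|a]].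
rewrite cycles_extend // (set_nth_default z) // -sz_z in s_next *.
have xu : s z \in x0 :: u by rewrite sz_z mem_nth.
have Ux : uniq (rcons (rcons p z) (s z) ++ rem (s z) (x0 :: u)).
  rewrite cat_rcons -(@perm_uniq _ (rcons p z ++ x0 :: u)) //.
  by rewrite perm_cat2l perm_to_rem.
have [|t Et Es] := IH (rcons p z) (s z) (rem (s z) (x0 :: u)) _ v Ux s_next.
  by rewrite size_rem.
exists (z :: t); first by rewrite Et cat_rcons.
(* So that removing [s z] from [m :: unused] leaves [m] in front. *)
have m_sz : m != s z.
  apply: contraTneq xu => <-; move: U; rewrite cat_uniq => /and3P[_ /hasPn dis _].
  apply/negP=> /dis /negP; apply; rewrite /m.
  by case: (p) => [|h q]; rewrite /= mem_head.
rewrite [map _ _]/= Es [in RHS]/= (negPf m_sz).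
by congr (_ :: one_line _ (_ :: _)); rewrite /m; case: (p).
Qed.

(** The letters 1 and 2 both write the first unused element next, in a new cycle
    or in the open one.  A letter a > 2 writes another one, which stays at its
    position in the cycle notation whatever comes afterwards. *)
Lemma flatten_cycles_in_order ls cur unused :
  size ls = (size unused).+1 -> valid_letters ls -> uniq unused ->
  (flatten (cycles ls cur unused) == cur ++ unused) = all (leq^~ 2) ls.
Proof.
elim: ls cur unused => [//|a ls IH] cur unused [sz] /andP[].
rewrite [size _]/= => a_ok v; case: unused sz => [|x0 u] sz U.
  move: a_ok; rewrite (size0nil sz) /=.
  by case: a => [|[|a]] //=; rewrite eqxx.
have [->|a1] := eqVneq a 1.
  rewrite cycles_close /= eqseq_cat // eqxx /=.
  by apply: (IH [:: x0]) => //; case/andP: U.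
have lt_a : (a.-1).-1 < size (x0 :: u).
  by rewrite -sz; case: a a1 a_ok => [|[|a]].
have xu : nth x0 (x0 :: u) a.-2 \in x0 :: u by apply: mem_nth.
rewrite cycles_extend //; have [a2|a2] := leqP a 2.
  have -> : a = 2 by case: a a1 a2 a_ok {lt_a xu} => [|[|[|a]]].
  rewrite [rem _ _]/= eqxx -cat_rcons.
  by apply: IH => //; case/andP: U.
rewrite [RHS]/= leqNgt a2 /=.
have [|d [rest ->]] := @cycles_prefix _ ls
    (rcons cur (nth x0 (x0 :: u) a.-2)) (rem (nth x0 (x0 :: u) a.-2) (x0 :: u)).
  by rewrite size_rem.
rewrite /= -catA cat_rcons eqseq_cat // eqxx /= eqseq_cons.
have -> // : (nth x0 (x0 :: u) a.-2 == x0) = false.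
rewrite -[X in _ == X]/(nth x0 (x0 :: u) 0) nth_uniq //.
by case: a a2 {a1 a_ok lt_a xu} => [|[|[|a]]].
Qed.

End Algorithms.

Section FixedPoints.
Variable n : nat.
Implicit Type w : word n.

Lemma map_f2_enum w : map (f2 w) (enum 'I_n) = f2_word w.
Proof.
have sz : size (f2_word w) = n.
  by rewrite (perm_size (f2_word_perm w)) size_enum_ord.
case: (posnP n) => [n0|n_gt0].
  by apply: etrans (esym (size0nil (etrans sz n0))); apply: size0nil;
    rewrite size_map size_enum_ord.
apply: (@eq_from_nth _ (Ordinal n_gt0)) => [|i].
  by rewrite size_map size_enum_ord sz.
rewrite size_map size_enum_ord => lt_i.
rewrite (nth_map (Ordinal n_gt0)) ?size_enum_ord // permE nth_enum_ord //.
by apply: set_nth_default; rewrite sz.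
Qed.

Lemma map_f3_flatten w : map (f3 w) (flatten (f3_cycles w)) = f2_word w.
Proof.
have s_next : {in f3_cycles w, forall c, {in c, f3 w =1 next c}}.
  by move=> c cw x; apply: f3E.
have := size_enum_ord n; have := enum_uniq 'I_n; move: s_next.
rewrite /f2_word /f3_cycles; case: (enum 'I_n) => [|x u] s_next U sz.
  by case: (backward w).
have [||t -> //] := @map_flatten_cycles _ (f3 w) (backward w) [::] x u _ _ U s_next.
- by rewrite size_backward.
- exact: valid_backward.
Qed.

(** The one-line word of [f2 w] lists the images under [f2 w] of 1, ..., n, and
    also those under [f3 w] of the elements in the order of the cycle notation. *)
Lemma f2_eq_f3_flatten w : f2 w = f3 w <-> flatten (f3_cycles w) = enum 'I_n.
Proof.
split=> E.
  by apply: (inj_map (@perm_inj _ (f3 w))); rewrite map_f3_flatten -map_f2_enum E.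
apply/permP=> i.
have /eq_in_map : map (f2 w) (enum 'I_n) = map (f3 w) (enum 'I_n).
  by rewrite -[in RHS]E map_f2_enum map_f3_flatten.
by apply; rewrite mem_enum.
Qed.

Lemma f2_eq_f3 w : f2 w = f3 w <-> forall i, w i <= 1.
Proof.
have all2 : (flatten (f3_cycles w) == enum 'I_n) = all (leq^~ 2) (backward w).
  have := enum_uniq 'I_n; have := size_enum_ord n.
  rewrite /f3_cycles; case: (enum 'I_n) => [|x u] sz U.
    by rewrite (size0nil (etrans (size_backward w) (esym sz))).
  apply: (flatten_cycles_in_order [:: x]); rewrite ?size_backward ?valid_backward //.
  by case/andP: U.
apply: (iff_trans (f2_eq_f3_flatten w)).
apply: (iff_trans (rwP eqP)); rewrite all2 all_map all_rev.
split=> [/allP w2 i|w2]; first by apply: w2; rewrite mem_enum.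
by apply/allP=> i _; apply: w2.
Qed.

Lemma letter12 w i : (letter w i \in [:: 1; 2]) = (w i <= 1).
Proof. by rewrite /letter; case: (w i : nat) => [|[]]. Qed.

(** The minimum accounts for the first position, where only the letter 1 is
    available. *)
Lemma card_ord_le1 i : #|[pred j : 'I_i.+1 | j <= 1]| = minn i.+1 2.
Proof.
rewrite -sum1_card big_mkcond big_ord_recl /=; case: i => [|i].
  by rewrite big_ord0.
by rewrite big_ord_recl big1.
Qed.

Lemma card_words_le1 : #|[set w : word n | [forall i, w i <= 1]]| = 2 ^ (n - 1).
Proof.
have := card_family (fun i : 'I_n => [pred j : 'I_i.+1 | j <= 1]).
rewrite cardsE => E; rewrite [LHS]E foldrE big_map big_enum /=.
under eq_bigr => i _ do rewrite card_ord_le1.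
case: n => [|m]; first by rewrite big_ord0.
rewrite big_ord_recl /= mul1n subn1 /=.
by under eq_bigr do rewrite (minn_idPr _) //; rewrite prod_nat_const card_ord.
Qed.

End FixedPoints.

Theorem theorem3 (n : nat) (n_ge1 : 1 <= n) :
  [/\ #|[set s : 'S_n | (@f2 n \o @f3_inv n) s == s]| = 2 ^ (n - 1),
      forall s : 'S_n,
        (@f2 n \o @f3_inv n) s = s <->
        exists w : word n,
          [/\ forall i, letter w i \in [:: 1; 2], s = f2 w & s = f3 w]
    & forall w : word n,
        (forall i, letter w i \in [:: 1; 2]) -> f2 w = f3 w].
Proof.
split.
- rewrite -card_words_le1 -(card_imset _ (@f3_inj n)); apply: eq_card => s.
  rewrite inE; apply/eqP/imsetP => [Es | [w w2 ->]].
    exists (f3_inv s); last by rewrite f3_invK.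
    by rewrite inE; apply/forallP/f2_eq_f3; rewrite f3_invK.
  by rewrite /= f3K; apply/f2_eq_f3/forallP; rewrite inE in w2.
- move=> s; split=> [Es | [w [_ s2 s3]]]; last by rewrite {1}s3 /= f3K.
  exists (f3_inv s); split; [|exact: esym|by rewrite f3_invK].
  by move=> i; rewrite letter12; move: i; apply/f2_eq_f3; rewrite f3_invK.
- by move=> w w12; apply/f2_eq_f3=> i; rewrite -letter12.
Qed.
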